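(* Let $P$ be a point and $\Pi$ a plane in three-dimensional Euclidean space $\mathbb R^3$. Then there is a unique plane through $P$ parallel to $\Pi$.
   Context: Planes in $\mathbb R^3$ are represented homogeneously by vectors of the four-dimensional real vector space $V=\operatorname{span}\{e_0,e_1,e_2,e_3\}$ not in $\mathbb R e_0$: the vector $v_0e_0+v_1e_1+v_2e_2+v_3e_3$ represents the plane with equation $v_0+v_1x+v_2y+v_3z=0$, and $v$ and $\lambda v$ ($\lambda\neq0$) represent the same plane. Two planes represented by $u,v\in V$ are parallel if and only if $u=\lambda v+\mu e_0$ for some $\lambda,\mu\in\mathbb R$ with $\lambda\neq0$; in particular every plane is parallel to itself. *)

(* Defs.v *)
From mathcomp Require Import all_boot all_order all_algebra.
From mathcomp Require Import all_classical all_reals.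
Set Implicit Arguments. Unset Strict Implicit. Unset Printing Implicit Defensive.
Import GRing.Theory.
Local Open Scope ring_scope.
Local Open Scope classical_set_scope.

Definition e0 (R : realType) : 'rV[R]_4 := delta_mx 0 0.

(* [v] lists the coordinates v_0, v_1, v_2, v_3; since [lift ord0 i] is the
   index i + 1, the equation reads v_0 + v_1 x + v_2 y + v_3 z = 0. *)
Definition solution_set (R : realType) (v : 'rV[R]_4) : set 'rV[R]_3 :=
  [set X | v 0 ord0 + \sum_(i < 3) v 0 (lift ord0 i) * X 0 i = 0].

Definition represents (R : realType) (v : 'rV[R]_4) (A : set 'rV[R]_3) : Prop :=
  ~ (exists c : R, v = c *: e0 R) /\ A = solution_set v.

(* A plane is a set of points, so the vectors v and l *: v, for l != 0,
   represent equal planes. *)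
Definition is_plane (R : realType) (A : set 'rV[R]_3) : Prop :=
  exists v : 'rV[R]_4, represents v A.

(* A representative is determined up to a nonzero factor, so the condition on
   u and v does not depend on which representatives are chosen. *)
Definition parallel (R : realType) (A B : set 'rV[R]_3) : Prop :=
  exists u v : 'rV[R]_4, [/\ represents u A, represents v B &
    exists l m : R, l != 0 /\ u = l *: v + m *: e0 R].

(* Main.v *)
Require Import Defs.
From mathcomp Require Import all_boot all_order all_algebra.
From mathcomp Require Import all_classical all_reals.
From mathcomp Require Import ring.
Local Open Scope ring_scope.
Local Open Scope classical_set_scope.
Import GRing.Theory.

(* If A is parallel to Pi, P lies on A and Q lies on Pi, then A is the
   translate of Pi by P - Q: the affine forms defining A and Pi have
   proportional linear parts. So Pi and P determine A, and no comparison of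
   different representatives of Pi is needed. For existence, the translate
   is cut out by the form of Pi with its constant term adjusted to vanish
   at P. *)

Definition plane_form {R : realType} (v : 'rV[R]_4) (X : 'rV[R]_3) : R :=
  v 0 ord0 + \sum_(i < 3) v 0 (lift ord0 i) * X 0 i.

Lemma solution_setE {R : realType} (v : 'rV[R]_4) X :
  solution_set v X = (plane_form v X = 0).
Proof. by []. Qed.

(** The form is linear in its vector, and [e0] gives the constant form 1. *)
Lemma plane_form_lin_e0 {R : realType} (l m : R) v X :
  plane_form (l *: v + m *: e0 R) X = l * plane_form v X + m.
Proof.
rewrite /plane_form /e0 !mxE /= mulrDr mulr1 mulr_sumr addrAC; congr (_ + _ + _).
by apply: eq_bigr => i _; rewrite !mxE /= mulr0 addr0 mulrA.
Qed.

(** An affine map respects combinations whose weights, here 1, -1 and 1, add up to 1: the constant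
    term survives exactly once. *)
Lemma plane_form_translate {R : realType} (v : 'rV[R]_4) X P Q :
  plane_form v (X - P + Q) = plane_form v X - plane_form v P + plane_form v Q.
Proof.
rewrite /plane_form.
under eq_bigr do rewrite !mxE mulrDr mulrBr.
by rewrite big_split sumrB /=; ring.
Qed.

(** Supplies the base point [Q] on [Pi] from which the translation is measured. *)
Lemma represents_nonempty {R : realType} (v : 'rV[R]_4) A :
  represents v A -> exists Q, A Q.
Proof.
move=> [v_nondeg ->].
have [/forallP v0|/forallPn[i vi]] :=
  boolP [forall i : 'I_3, v 0 (lift ord0 i) == 0].
  (* With all linear coefficients zero, [v] would be a multiple of [e0]. *)
  case: v_nondeg; exists (v 0 ord0); apply/rowP => j; rewrite !mxE eqxx /=.
  have [k ->|->] := unliftP ord0 j; last by rewrite eqxx mulr1.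
  by rewrite (eqP (v0 k)) mulr0.
(* The point where the plane meets the [i]-th coordinate axis. *)
exists ((- (v 0 ord0 / v 0 (lift ord0 i))) *: delta_mx 0 i).
rewrite /solution_set /= (bigD1 i) //= big1 => [|j /negPf ji];
  rewrite !mxE ?eqxx ?ji ?andbF /= ?mulr0 //.
by field.
Qed.

Lemma parallel_translate {R : realType} (A Pi : set 'rV[R]_3) P Q :
  parallel A Pi -> A P -> Pi Q -> A = [set X | Pi (X - P + Q)].
Proof.
move=> [u [v [[_ ->] [_ ->] [l [m [l0 ->]]]]]].
rewrite !solution_setE plane_form_lin_e0 => uP vQ; apply/funext => X; apply/propext.
rewrite /= !solution_setE plane_form_lin_e0 plane_form_translate vQ addr0.
(* By [uP], [m] equals [- l * plane_form v P]; the factor [l] can then be cancelled. *)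
have -> : l * plane_form v X + m = l * (plane_form v X - plane_form v P).
  by rewrite -[RHS]addr0 -uP; ring.
by split=> [/eqP|->]; rewrite ?mulr0 // mulf_eq0 (negPf l0) => /eqP.
Qed.

Lemma parallel_through {R : realType} (Pi : set 'rV[R]_3) P :
  is_plane Pi -> exists A, [/\ is_plane A, A P & parallel A Pi].
Proof.
move=> [v rv]; have [v_nondeg _] := rv.
(* The explicit factor 1 gives [u] the shape required by both [plane_form_lin_e0] and [parallel]. *)
pose u := 1 *: v + (- plane_form v P) *: e0 R.
have ru : represents u (solution_set u).
  split=> // -[c uc]; apply: v_nondeg; exists (c + plane_form v P).
  by rewrite scalerDl -uc /u scale1r scaleNr addrNK.
exists (solution_set u); split; first by exists u.
  by rewrite solution_setE plane_form_lin_e0 mul1r subrr.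
exists u, v; split=> //; exists 1, (- plane_form v P).
by split; first exact: oner_neq0.
Qed.

Theorem theorem2p4 (R : realType) (P : 'rV[R]_3) (Pi : set 'rV[R]_3)
    (hPi : is_plane Pi) :
  exists! A : set 'rV[R]_3, [/\ is_plane A, A P & parallel A Pi].
Proof.
have [A [Apl AP parA]] := parallel_through Pi P hPi.
have [v /represents_nonempty[Q PiQ]] := hPi.
exists A; split=> // B [_ BP parB].
(* With the same [P] and [Q], both sides become the same preimage of [Pi]. *)
by rewrite (parallel_translate _ _ P Q parA) // (parallel_translate _ _ P Q parB).
Qed.
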